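(* Let $\mathcal{X}$ be a Banach space of analytic functions on $\mathbb{D}$ such that (i) $\mathcal{F}\subseteq\mathcal{X}$, and (ii) for every disk automorphism $\phi\in\mathrm{Aut}(\mathbb{D})$, the composition operator $C_\phi$ is bounded on $\mathcal{X}$ and $\rho(C_\phi)=1$. Let $\varphi$ be an elliptic disk automorphism with fixed point $a\in\mathbb{D}$. Then the spectrum of $C_\varphi$ acting on $\mathcal{X}$ is the closure of the set of positive powers of $\varphi'(a)$, i.e. $\sigma(C_\varphi)=\overline{\{\varphi'(a)^k:k=1,2,3,\dots\}}$. Moreover, this closure is a finite subgroup of the unit circle $\partial\mathbb{D}$ if $\varphi'(a)^n=1$ for some natural number $n\geq 1$, and is the whole unit circle $\partial\mathbb{D}$ otherwise.
   Context: $\mathbb{D}=\{z\in\mathbb{C}:|z|<1\}$ and $\partial\mathbb{D}$ is the unit circle. $\mathrm{Aut}(\mathbb{D})$ is the group of analytic bijections of $\mathbb{D}$, i.e. the maps $z\mapsto\lambda\frac{a-z}{1-\overline{a}z}$ with $|\lambda|=1$, $a\in\mathbb{D}$. A disk automorphism is elliptic if, as a Möbius map of the Riemann sphere, it has exactly one fixed point in $\mathbb{D}$ and one in the complement of $\overline{\mathbb{D}}$. A Banach space of analytic functions on $\mathbb{D}$ is a complex vector space of analytic functions $\mathbb{D}\to\mathbb{C}$ (with pointwise operations) that is complete under a given norm. For an analytic self-map $\varphi$ of $\mathbb{D}$, $C_\varphi f=f\circ\varphi$. For a bounded operator $T$ on $\mathcal{X}$, $\sigma(T)=\{\lambda\in\mathbb{C}:T-\lambda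 I\text{ is not invertible}\}$ and $\rho(T)=\sup\{|\lambda|:\lambda\in\sigma(T)\}$. The family $\mathcal{F}$ is the union of: the functions $f_s(z)=\exp\left(\frac{s(z+1)}{z-1}\right)$ for real $s\ge 0$; the functions $f_t(z)=\left(\frac{1+z}{1-z}\right)^{it}=\exp\left(it\log\frac{1+z}{1-z}\right)$ for $t\in\mathbb{R}$ ($\log$ the principal branch); and the monomials $z^k$ for $k\in\mathbb{N}=\{1,2,\dots\}$. *)

(* Defs.v *)
From HB Require Import structures.
From mathcomp Require Import all_boot all_order all_algebra.
From mathcomp Require Import complex.
From mathcomp Require Import all_classical all_reals all_analysis.

Set Implicit Arguments.
Unset Strict Implicit.
Unset Printing Implicit Defensive.

Import Order.TTheory GRing.Theory Num.Theory.
Import numFieldNormedType.Exports.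

Local Open Scope classical_set_scope.
Local Open Scope ring_scope.

(* The field of complex numbers is R[i] for R : realType, with its `|_| taking
   values in R[i] itself.  MathComp-Analysis attaches the topology to the
   regular module R[i]^o, hence the casts below. *)

Definition disk (R : realType) : set R[i] := [set z | `|z| < 1].

Definition circle (R : realType) : set R[i] := [set z | `|z| = 1].

(* A function on the disk is represented by a total function R[i] -> R[i] of
   which only the values on the disk matter. *)
Definition analytic_on_disk (R : realType) (f : R[i] -> R[i]) : Prop :=
  forall z, disk z -> derivable (f : R[i]^o -> R[i]^o) z 1.

Definition cderiv (R : realType) (f : R[i] -> R[i]) (z : R[i]) : R[i] :=
  derive1 (f : R[i] -> R[i]^o) z.

Definition cexp (R : realType) (z : R[i]) : R[i] :=
  (expR (complex.Re z))%:C%C *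
  Complex (cos (complex.Im z)) (sin (complex.Im z)).

(* Principal argument, in ]-pi, pi] for z != 0. *)
Definition carg (R : realType) (z : R[i]) : R :=
  let t := acos (complex.Re z / Normc.normc z) in
  if 0 <= complex.Im z then t else - t.

(* Principal branch, for z != 0. *)
Definition clog (R : realType) (z : R[i]) : R[i] :=
  Complex (ln (Normc.normc z)) (carg z).

Definition family_F (R : realType) : set (R[i] -> R[i]) :=
  [set (fun z : R[i] => cexp (s%:C%C * (z + 1) / (z - 1)))
     | s in [set s : R | 0 <= s]] `|`
  [set (fun z : R[i] => cexp ('i%C * t%:C%C * clog ((1 + z) / (1 - z))))
     | t in [set: R]] `|`
  [set (fun z : R[i] => z ^+ k) | k in [set k : nat | (0 < k)%N]].

(* Aut(D): the analytic bijections of the disk onto itself. *)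
Definition disk_automorphism (R : realType) (phi : R[i] -> R[i]) : Prop :=
  analytic_on_disk phi /\ set_bij (@disk R) (@disk R) phi.

(* z |-> (a z + b) / (c z + d) on the Riemann sphere option R[i], where None is
   the point at infinity; meaningful when a d != b c. *)
Definition moebius (R : realType) (a b c d : R[i]) (w : option R[i]) :
    option R[i] :=
  match w with
  | Some z => if c * z + d == 0 then None else Some ((a * z + b) / (c * z + d))
  | None => if c == 0 then None else Some (a / c)
  end.

(* z |-> l (b - z) / (1 - conj(b) z) *)
Definition disk_moebius (R : realType) (l b : R[i]) :
    option R[i] -> option R[i] :=
  moebius (- l) (l * b) (- (b^*)%C) 1.

Definition outside_closed_disk (R : realType) (w : option R[i]) : Prop :=
  if w is Some z then 1 < `|z| else True.

Definition elliptic (R : realType) (phi : R[i] -> R[i]) : Prop :=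
  exists l b : R[i],
    [/\ `|l| = 1,
        `|b| < 1,
        forall z, disk z -> disk_moebius l b (Some z) = Some (phi z),
        exists! z, disk z /\ disk_moebius l b (Some z) = Some z
      & exists! w, outside_closed_disk w /\ disk_moebius l b w = w].

(* A Banach space of analytic functions on the disk: a complex Banach space
   whose vectors are identified with functions on the disk by an injective map,
   linear for the pointwise operations. *)
Record banach_analytic (R : realType) := BanachAnalytic {
  ba_space :> completeNormedModType R[i];
  ba_fun : ba_space -> R[i] -> R[i];
  ba_fun_linear : forall (c : R[i]) (f g : ba_space) (z : R[i]), disk z ->
    ba_fun (c *: f + g) z = c * ba_fun f z + ba_fun g z;
  ba_fun_inj : forall f g : ba_space,
    (forall z, disk z -> ba_fun f z = ba_fun g z) -> f = g;
  ba_fun_analytic : forall f : ba_space, analytic_on_disk (ba_fun f) }.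

(* The element f of X is the function h on the disk. *)
Definition represents (R : realType) (X : banach_analytic R) (f : X)
    (h : R[i] -> R[i]) : Prop :=
  forall z, disk z -> ba_fun f z = h z.

Definition bounded_operator (R : realType) (X : completeNormedModType R[i])
    (T : X -> X) : Prop :=
  linear T /\ exists M : R, forall f : X, `|T f| <= M%:C%C * `|f|.

(* f |-> f \o phi as a map of X to itself; where f \o phi is not in X the value
   is the dummy 0, which is excluded by comp_bounded. *)
Definition comp_op (R : realType) (X : banach_analytic R)
    (phi : R[i] -> R[i]) (f : X) : X :=
  xget 0 [set g : X | represents g (ba_fun f \o phi)].

Definition comp_bounded (R : realType) (X : banach_analytic R)
    (phi : R[i] -> R[i]) : Prop :=
  (forall f : X, exists g : X, represents g (ba_fun f \o phi)) /\
  bounded_operator (@comp_op R X phi).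

Definition invertible_operator (R : realType) (X : completeNormedModType R[i])
    (T : X -> X) : Prop :=
  exists S : X -> X, [/\ bounded_operator S, cancel T S & cancel S T].

Definition spectrum (R : realType) (X : completeNormedModType R[i])
    (T : X -> X) : set R[i] :=
  [set mu | ~ invertible_operator (fun f : X => T f - mu *: f)].

(* sup is 0 on empty and on unbounded sets of reals. *)
Definition spectral_radius (R : realType) (X : completeNormedModType R[i])
    (T : X -> X) : R :=
  sup [set Normc.normc mu | mu in spectrum T].

Definition positive_powers (R : realType) (c : R[i]) : set R[i] :=
  [set c ^+ k | k in [set k : nat | (0 < k)%N]].

Definition cclosure (R : realType) (A : set R[i]) : set R[i] :=
  closure (A : set R[i]^o).

Definition circle_subgroup (R : realType) (G : set R[i]) : Prop :=
  [/\ G `<=` @circle R,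
      G 1,
      forall x y, G x -> G y -> G (x * y)
    & forall x, G x -> G x^-1].

(* Main.v *)
Require Import Defs.
From HB Require Import structures.
From mathcomp Require Import all_boot all_order all_algebra.
From mathcomp Require Import complex.
From mathcomp Require Import all_classical all_reals all_analysis.
From mathcomp Require Import ring lra.

(* The involution psi(z) = (a - z)/(1 - conj(a) z) conjugates phi to the rotation
   by c = phi'(a), |c| = 1, so psi^k is an eigenvector of C_phi for c^k; limits
   of eigenvalues are approximate eigenvalues, hence the closure of the powers
   of c lies in the spectrum.  Conversely, rho(C_phi) = rho(C_phi^-1) = 1 puts
   the spectrum on the unit circle, which is that closure when c is not a root
   of unity; and if c is a primitive m-th root of unity then C_phi^m = 1, so the
   spectrum consists of m-th roots of unity, i.e. of powers of c. *)

Set Implicit Arguments.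
Unset Strict Implicit.
Unset Printing Implicit Defensive.

Import Order.TTheory GRing.Theory Num.Theory.
Import numFieldNormedType.Exports.

Local Open Scope classical_set_scope.
Local Open Scope ring_scope.

(** * Algebra of the Moebius maps of the disk *)

Definition mob (R : realType) (l b z : R[i]) : R[i] :=
  l * (b - z) / (1 - (b^*)%C * z).

Section Moebius.
Variable R : realType.
Implicit Types l b z a : R[i].

Lemma mob_den_neq0 b z : `|b| < 1 -> `|z| < 1 -> 1 - (b^*)%C * z != 0.
Proof.
move=> hb hz; rewrite subr_eq0; apply/eqP => /(congr1 (fun x : R[i] => `|x|)).
rewrite normrM normcJ normr1 => e.
by have := mulr_ilt1 (normr_ge0 b) (normr_ge0 z) hb hz; rewrite -e ltxx.
Qed.

(** With |w|^2 = w conj(w), clearing the denominator leaves a polynomial identity. It gives the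
    invariance of the disk and, at a fixed point, the modulus of the multiplier. *)
Lemma one_sub_sqr_mob l b z : `|l| = 1 -> `|b| < 1 -> `|z| < 1 ->
  1 - `|mob l b z| ^+ 2 =
  (1 - `|b| ^+ 2) * (1 - `|z| ^+ 2) / `|1 - (b^*)%C * z| ^+ 2.
Proof.
move=> hl hb hz; have hd := mob_den_neq0 hb hz.
rewrite /mob !normrM hl mul1r normfV.
have hn : `|1 - (b^*)%C * z| ^+ 2 != 0 by rewrite expf_eq0 /= normr_eq0.
apply: (mulIf hn); rewrite divfK // mulrBl mul1r exprMn exprVn divfK //.
rewrite !sqr_normc !(rmorphB, rmorphM, rmorph1) /= conjcK; ring.
Qed.

Lemma mob_disk l b z : `|l| = 1 -> `|b| < 1 -> `|z| < 1 -> `|mob l b z| < 1.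
Proof.
move=> hl hb hz; have hd := mob_den_neq0 hb hz.
rewrite -(@expr_lt1 _ 2) // -subr_gt0 one_sub_sqr_mob //.
by rewrite divr_gt0 ?mulr_gt0 ?subr_gt0 ?expr_lt1 ?exprn_gt0 ?normr_gt0.
Qed.

Lemma unit_conj l : `|l| = 1 -> (l^*)%C = l^-1.
Proof. by move=> hl; rewrite invc_norm hl expr1n invr1 mul1r. Qed.

Lemma unit_neq0 l : `|l| = 1 -> l != 0.
Proof. by move=> hl; rewrite -normr_eq0 hl oner_eq0. Qed.

(** The inverse stays in the family, with parameters l^-1 and l b; for l = 1 the map is an
    involution. In the composite, numerator and denominator share the factor 1 - |b|^2, which is
    nonzero. *)
Lemma mobK l b z : `|l| = 1 -> `|b| < 1 -> `|z| < 1 ->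
  mob l^-1 (l * b) (mob l b z) = z.
Proof.
move=> hl hb hz; have hl0 := unit_neq0 hl; have hd := mob_den_neq0 hb hz.
have hlb : `|l * b| < 1 by rewrite normrM hl mul1r.
have := mob_den_neq0 hlb (mob_disk hl hb hz).
rewrite /mob rmorphM /= (unit_conj hl).
have hb2 : 1 - (b^*)%C * b != 0 by exact: mob_den_neq0.
move=> hd2; field; rewrite hl0 hd /=.
by have -> : 1 - (b^*)%C * z - (b^*)%C * (b - z) = 1 - (b^*)%C * b by ring.
Qed.

(** Let D be the difference of the two sides. The fixed-point equation [e1] and its conjugate [e2]
    give D = |a|^2 D, and |a| < 1 forces D = 0. The identity serves to factor the denominator in
    [mob_conj_rotation]. *)
Lemma mob_fixed_swap l b a : `|l| = 1 -> `|b| < 1 -> `|a| < 1 ->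
  mob l b a = a -> l * (a^*)%C * b = (b^*)%C * a.
Proof.
move=> hl hb ha; have hd := mob_den_neq0 hb ha => e.
have hl0 := unit_neq0 hl.
have e1 : a * (1 - (b^*)%C * a) = l * (b - a) by rewrite -{1}e /mob divfK.
have e2 : l * ((a^*)%C * (1 - b * (a^*)%C)) = (b^*)%C - (a^*)%C.
  rewrite -[RHS](mulVKf hl0); congr (_ * _); rewrite -(unit_conj hl).
  by move/(congr1 (@conjc R)): e1; rewrite !(rmorphB, rmorphM, rmorph1) /= conjcK.
have h : 1 - a * (a^*)%C != 0 by rewrite mulrC; exact: mob_den_neq0.
apply: (mulIf h).
have k1 : l * b = a * (1 - (b^*)%C * a) + l * a by rewrite e1; ring.
have k2 : (b^*)%C = l * ((a^*)%C * (1 - b * (a^*)%C)) + (a^*)%C by rewrite e2; ring.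
have x : l * (a^*)%C * b = (a^*)%C * a * (1 - (b^*)%C * a + l).
  by rewrite mulrAC k1; ring.
have y : (b^*)%C * a = (a^*)%C * a * (l * (1 - b * (a^*)%C) + 1).
  by rewrite {1}k2; ring.
have d : l * (a^*)%C * b - (b^*)%C * a = (a^*)%C * a * (1 - (b^*)%C * a + l)
    - (a^*)%C * a * (l * (1 - b * (a^*)%C) + 1) by rewrite -x -y.
apply/eqP; rewrite -subr_eq0; apply/eqP.
transitivity (l * (a^*)%C * b - (b^*)%C * a
  - (l * (a^*)%C * b - (b^*)%C * a) * ((a^*)%C * a)); first by ring.
by rewrite {1}d; ring.
Qed.

(* The factor is the derivative of mob l b at its fixed point a. *)
Lemma mob_conj_rotation l b a z : `|l| = 1 -> `|b| < 1 -> `|a| < 1 ->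
  `|z| < 1 -> mob l b a = a ->
  mob 1 a (mob l b z) =
    l * ((b^*)%C * b - 1) / (1 - (b^*)%C * a) ^+ 2 * mob 1 a z.
Proof.
move=> hl hb ha hz e; have sw := mob_fixed_swap hl hb ha e.
have hda := mob_den_neq0 hb ha; have hdz := mob_den_neq0 hb hz.
have haz := mob_den_neq0 ha hz; have ham := mob_den_neq0 ha (mob_disk hl hb hz).
(* Writing a as [mob l b a] makes this a difference of two values of the map, which has a - z as a
   factor. *)
have num : a - mob l b z =
    l * ((b^*)%C * b - 1) * (a - z) / ((1 - (b^*)%C * a) * (1 - (b^*)%C * z)).
  by rewrite -{1}e /mob; field; rewrite hda hdz.
have e1 : a * (1 - (b^*)%C * a) = l * (b - a) by rewrite -{1}e /mob divfK.
have hl0 := unit_neq0 hl.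
have e2 : l * ((a^*)%C * (1 - b * (a^*)%C)) = (b^*)%C - (a^*)%C.
  rewrite -[RHS](mulVKf hl0); congr (_ * _); rewrite -(unit_conj hl).
  by move/(congr1 (@conjc R)): e1; rewrite !(rmorphB, rmorphM, rmorph1) /= conjcK.
(* Compare coefficients in z after clearing 1 - conj(b) z: the constant terms agree by [sw], the
   linear ones by [e2] and [sw]. *)
have den : 1 - (a^*)%C * mob l b z =
    (1 - (b^*)%C * a) * (1 - (a^*)%C * z) / (1 - (b^*)%C * z).
  apply: (mulIf hdz); rewrite divfK // /mob.
  transitivity (1 - (b^*)%C * z - l * (a^*)%C * b + l * (a^*)%C * z).
    by field.
  rewrite sw; have -> : l * (a^*)%C = (b^*)%C - (a^*)%C + (b^*)%C * a * (a^*)%C.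
    by rewrite -sw -e2; ring.
  by ring.
rewrite {1}/mob num den /mob; field.
by rewrite hda hdz haz.
Qed.

(** At the fixed point, [one_sub_sqr_mob] has 1 - |a|^2 on both sides; cancelling it leaves 1 = (1 -
    |b|^2) / |1 - conj(b) a|^2, the modulus sought. *)
Lemma norm_multiplier l b a : `|l| = 1 -> `|b| < 1 -> `|a| < 1 ->
  mob l b a = a -> `|l * ((b^*)%C * b - 1) / (1 - (b^*)%C * a) ^+ 2| = 1.
Proof.
move=> hl hb ha e; have hd := mob_den_neq0 hb ha.
have := one_sub_sqr_mob hl hb ha; rewrite e.
have h1 : 0 < 1 - `|a| ^+ 2 by rewrite subr_gt0 expr_lt1.
have hn : `|1 - (b^*)%C * a| ^+ 2 != 0 by rewrite expf_eq0 /= normr_eq0.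
rewrite mulrAC -[LHS]mul1r => /(mulIf (lt0r_neq0 h1)) h.
rewrite normf_div normrM hl mul1r normrX [RHS]h; congr (_ / _).
by rewrite distrC (mulrC (b^*)%C) -sqr_normc ger0_norm // subr_ge0 expr_le1 // ltW.
Qed.
End Moebius.

(** * Derivative of a Moebius map *)

Section MoebiusDerivative.
Variables (K : numFieldType) (l b c : K).
(** For differentiation in z, conj(b) is a constant, here the free parameter [c]. *)
Let f : K -> K := fun z => l * (b - z) / (1 - c * z).

Lemma fracl_den_cvg (a : K) (F : set_system K) {FF : Filter F} : F --> (0 : K) ->
  (1 - c * a) * (1 - c * (h + a)) @[h --> F] --> (1 - c * a) ^+ 2.
Proof.
move=> F0; rewrite expr2 -{4}(add0r a).
apply: cvgM; first exact: cvg_cst.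
apply: cvgB; first exact: cvg_cst.
apply: cvgM; first exact: cvg_cst.
by apply: cvgD; last exact: cvg_cst.
Qed.

Lemma fracl_cvg_quotient (a : K) : 1 - c * a != 0 ->
  h^-1 *: (f (h + a) - f a) @[h --> 0^'] -->
  l * (c * b - 1) / (1 - c * a) ^+ 2.
Proof.
move=> h0.
(* The difference quotient after cancelling h; it is continuous at 0. *)
pose g (h : K) : K := l * (c * b - 1) / ((1 - c * a) * (1 - c * (h + a))).
have F0 : (0 : K)^' --> (0 : K) by exact: (@cvg_within _ _ _).
have cden : (1 - c * a) * (1 - c * (h + a)) @[h --> (0 : K)^'] --> (1 - c * a) ^+ 2.
  exact: fracl_den_cvg.
have hden : (1 - c * a) ^+ 2 != 0 by rewrite expf_neq0.
have cg : g @ (0 : K)^' --> l * (c * b - 1) / (1 - c * a) ^+ 2.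
  apply: (@cvgM K K (0 : K)^' _ (cst _)
    (fun h => ((1 - c * a) * (1 - c * (h + a)))^-1)); first exact: cvg_cst.
  by apply: cvgV; [exact: hden | exact: cden].
apply: cvg_trans cg; apply: near_eq_cvg.
have nz : \forall h \near (0 : K)^', (1 - c * a) * (1 - c * (h + a)) != 0.
  exact: cvgr_neq0 cden hden.
near=> h.
have hh : h != 0 by near: h; exact: nbhs_dnbhs_neq.
have : (1 - c * a) * (1 - c * (h + a)) != 0 by near: h.
rewrite mulf_eq0 negb_or => /andP[_ h1].
rewrite /g /f /GRing.scale /=; field.
by rewrite hh h0 h1.
Unshelve. all: by end_near.
Qed.

Lemma fracl_derivable (a : K) : 1 - c * a != 0 -> derivable f a 1.
Proof.
move=> h; apply/cvg_ex; eexists.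
have := fracl_cvg_quotient h; apply: cvg_trans; apply: near_eq_cvg.
by near=> x; rewrite /= /GRing.scale /= mulr1.
Unshelve. all: by end_near.
Qed.

Lemma shift_cvg (a : K) (F : set_system K) {FF : Filter F} : F --> (0 : K) ->
  x + a @[x --> F] --> a.
Proof.
by move=> F0; rewrite -[X in _ --> X]add0r; apply: cvgD; last exact: cvg_cst.
Qed.

(** Stated for any [g] equal to [f] near a, because [phi] is prescribed only on the disk. *)
Lemma fracl_derive1 (a : K) (g : K -> K) : 1 - c * a != 0 ->
  (\forall z \near a, g z = f z) ->
  derive1 g a = l * (c * b - 1) / (1 - c * a) ^+ 2.
Proof.
move=> h e; apply: cvg_lim; first exact: norm_hausdorff.
have := fracl_cvg_quotient h; apply: cvg_trans; apply: near_eq_cvg.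
have ea : g a = f a by apply: nbhs_singleton e.
have sh : \forall x \near (0 : K)^', g (x + a) = f (x + a).
  have F0 : (0 : K)^' --> (0 : K) by exact: (@cvg_within _ _ _).
  exact: (@shift_cvg a _ _ F0 _ e).
by near=> x; rewrite ea; congr (_ *: (_ - _)); apply/esym; near: x.
Unshelve. all: by end_near.
Qed.
End MoebiusDerivative.

(** * Angles on the unit circle and density of powers *)

Section Angles.
Variable R : realType.
Implicit Types (t : R) (z : R[i]).

Definition cis t : R[i] := Complex (cos t) (sin t).

Lemma cisD s t : cis (s + t) = cis s * cis t.
Proof. by rewrite /cis cosD sinD; congr Complex; rewrite addrC (mulrC (sin s)). Qed.

Lemma cis0 : cis 0 = 1.
Proof. by rewrite /cis cos0 sin0. Qed.

Lemma cisMn t n : cis (t *+ n) = cis t ^+ n.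
Proof. by elim: n => [|n IH]; rewrite ?mulr0n ?cis0 // mulrS cisD IH exprS. Qed.

Lemma cis_period n : cis ((pi *+ 2) *+ n) = 1.
Proof. by rewrite cisMn /cis cos2pi sin2pi expr1n. Qed.

Lemma norm_cis t : `|cis t| = 1.
Proof. by rewrite normc_def /= cos2Dsin2 sqrtr1. Qed.

Lemma norm1_cis z : `|z| = 1 -> exists t, z = cis t.
Proof.
case: z => x y; rewrite normc_def => -[] /= h.
have hs : x ^+ 2 + y ^+ 2 = 1.
  rewrite -[LHS]sqr_sqrtr ?h ?expr1n //.
  by rewrite addr_ge0 ?sqr_ge0.
have hx : -1 <= x <= 1.
  rewrite -ler_norml -(@expr_le1 _ 2) // real_normK ?num_real //.
  by rewrite -hs lerDl sqr_ge0.
have [c1 c2] := acos_def hx.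
have sn : sin (acos x) = `|y|.
  by rewrite sin_acos // -hs addrAC subrr add0r sqrtr_sqr.
have [y0|y0] := leP 0 y.
  by exists (acos x); rewrite /cis c2 sn ger0_norm.
by exists (- acos x); rewrite /cis cosN sinN c2 sn ltr0_norm // opprK.
Qed.


(** Mean value theorem: t - sin t has derivative 1 - cos t >= 0. *)
Lemma sin_le_id t : 0 <= t -> sin t <= t.
Proof.
move=> t0.
have d (x : R) : is_derive x 1 (fun x => x - sin x) (1 - cos x).
  exact: is_deriveB.
have ct : {within `[0, t], continuous (fun x : R => x - sin x)}.
  apply: continuous_subspaceT => x.
  by apply: cvgB; [exact: cvg_id | exact: continuous_sin].
have [c _] := MVT_segment t0 (fun x _ => d x) ct.
rewrite sin0 subr0 subr0 => e; rewrite -subr_ge0 e subr0.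
by rewrite mulr_ge0 // subr_ge0 cos_le1.
Qed.

Lemma norm_sin_le t : `|sin t| <= `|t|.
Proof.
wlog t0 : t / 0 <= t.
  move=> h; have [/h//|t0] := leP 0 t.
  by have := h (- t); rewrite sinN !normrN => -> //; rewrite oppr_ge0 ltW.
rewrite ler_norml (ger0_norm t0) sin_le_id // andbT.
(* For -t <= sin t: up to 1 <= pi the sine is nonnegative, and beyond 1 the bound -1 <= sin t is
   enough. *)
have [t1|t1] := leP t 1.
  rewrite (@le_trans _ _ 0) ?oppr_le0 // sin_ge0_pi // t0 /=.
  by rewrite (le_trans t1) // (le_trans _ (pi_ge2 R)) ?ler1n.
by rewrite (le_trans _ (sin_geN1 t)) // lerN2 ltW.
Qed.

(** Half-angle factorisation cis t - 1 = 2 i sin(t/2) cis(t/2), then |sin u| <= |u|. *)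
Lemma norm_cis_sub1 t : `|cis t - 1| <= `|t|%:C%C.
Proof.
have -> : cis t - 1 = cis (t / 2) * ((sin (t / 2))%:C%C * 'i%C * 2).
  have -> : t = t / 2 + t / 2 by lra.
  set u := (_ / 2); rewrite /cis.
  have -> : (u + u) / 2 = u by lra.
  rewrite cosD sinD; have := cos2Dsin2 u; move: (cos u) (sin u) => c s h.
  apply/eqP; rewrite eq_complex /=; apply/andP; split; apply/eqP; last by ring.
  have -> : c * c = 1 - s * s by rewrite -h; ring. ring.
rewrite normrM norm_cis mul1r !normrM.
have -> : `|'i%C : R[i]| = 1 by rewrite normc_def /= expr0n expr1n add0r sqrtr1.
rewrite mulr1 normr_nat normc_def /= expr0n /= addr0 sqrtr_sqr.
have -> : 2 = (2 : R)%:C%C :> R[i] by rewrite rmorph_nat.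
rewrite -rmorphM lecR /=; have := norm_sin_le (t / 2).
by rewrite normrM normfV normr_nat; lra.
Qed.

Lemma cisN t : cis (- t) = (cis t)^-1.
Proof.
have h : cis (- t) * cis t = 1 by rewrite -cisD addNr cis0.
by rewrite -[LHS]mulr1 -(mulfV (unit_neq0 (norm_cis t))) mulrA h mul1r.
Qed.

Lemma cisB_period t (m : int) : cis (t - (pi *+ 2) *~ m) = cis t.
Proof.
rewrite cisD cisN; case: m => m; first by rewrite -pmulrn cis_period invr1 mulr1.
by rewrite NegzE mulrNz cisN invrK cis_period mulr1.
Qed.

(* Pigeonhole on the angles k b mod 2 pi. *)
Lemma small_angle (b e : R) : 0 < e -> exists k t,
  [/\ (0 < k)%N, cis b ^+ k = cis t & `|t| < e].
Proof.
move=> e0.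
have p0 : (0 : R) < pi *+ 2 by rewrite mulrn_wgt0 ?pi_gt0.
(* The representative of k b modulo 2 pi in [0, 2 pi[. *)
pose fr (k : nat) : R := b *+ k - (pi *+ 2) *~ Num.floor (b *+ k / (pi *+ 2)).
have fr0 k : 0 <= fr k.
  by rewrite /fr subr_ge0 -mulrzr mulrC -ler_pdivlMr // floor_le.
have fr1 k : fr k < pi *+ 2.
  have := floorD1_gt (b *+ k / (pi *+ 2)).
  rewrite intrD ltr_pdivrMr // mulrDl mul1r /fr ltrBlDl.
  by rewrite -(mulrzr (pi *+ 2)) (mulrC (pi *+ 2)).
have cfr k : cis (fr k) = cis b ^+ k by rewrite cisB_period cisMn.
(* Cut the circle into N arcs of length 2 pi / N < e; the integer part of [x k] below is the index
   of the arc containing [fr k]. *)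
pose N := (Num.trunc (pi *+ 2 / e)).+1.
have N0 : (0 : R) < N%:R by rewrite ltr0n.
have Ne : pi *+ 2 < e * N%:R.
  by rewrite mulrC -ltr_pdivrMr // truncnS_gt.
pose x k := fr k / (pi *+ 2) * N%:R.
have x0 k : 0 <= x k by rewrite !mulr_ge0 // ?invr_ge0 ltW.
have xN k : x k < N%:R.
  by rewrite /x -{2}(mul1r N%:R) ltr_pM2r // ltr_pdivrMr // mul1r.
have [i [j [ij xij]]] : exists i j, (i < j)%N /\ Num.trunc (x i) = Num.trunc (x j).
  apply: contrapT => H.
  (* Were no arc shared, the first N + 1 indices would inject into the N arcs. *)
  suff : (N.+1 <= N)%N by rewrite ltnn.
  apply: (@pigeonhole _ _ (fun k => Num.trunc (x k))).
    move=> i j _ _ xij; case: (ltngtP i j) => // lij; exfalso; apply: H.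
      by exists i, j.
    by exists j, i.
  by move=> _ [k _ <-] /=; rewrite truncn_lt_nat.
exists (j - i)%N, (fr j - fr i); split; first by rewrite subn_gt0.
  apply: (mulIf (expf_neq0 i (unit_neq0 (norm_cis b)))).
  rewrite -exprD subnK ?(ltnW ij) // cisD cisN !cfr divfK //.
  by rewrite expf_neq0 // unit_neq0 // norm_cis.
have /andP[i1 i2] := truncn_itv (x0 i); have /andP[j1 j2] := truncn_itv (x0 j).
have : `|x j - x i| < 1.
  by rewrite ltr_norml; move: i1 i2 j1 j2; rewrite xij -natr1; lra.
rewrite /x -mulrBl -mulrBl !normrM (gtr0_norm N0) normfV (gtr0_norm p0).
rewrite -ltr_pdivlMr // mul1r ltr_pdivrMr // => h.
apply: (lt_trans h); rewrite mulrC ltr_pdivrMr //.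
Qed.

(** Some power of [cis b] has an angle t with 0 < |t| < e; its own powers go round the circle in
    steps of |t|, so one of them falls within e of z. *)
Lemma cis_dense (b : R) z (e : R) :
  ~ (exists n : nat, (1 <= n)%N /\ cis b ^+ n = 1) -> `|z| = 1 -> 0 < e ->
  exists2 k : nat, (0 < k)%N & `|cis b ^+ k - z| < e%:C%C.
Proof.
move=> nroot /norm1_cis[al ->] e0.
have [k [t [k0 bk te]]] := small_angle b e0.
have t0 : t != 0.
  by apply/eqP => t0; apply: nroot; exists k; rewrite bk t0 cis0.
have p0 : (0 : R) < pi *+ 2 by rewrite mulrn_wgt0 ?pi_gt0.
(* Shift the angle of z by a multiple of 2 pi to the side of 0 where t lies, past t itself: the
   number j of steps is then positive, whatever the sign of t. *)
have [al' <- h] : exists2 al', cis al' = cis al & 1 <= al' / t.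
  have [t1|t1|] := ltgtP t 0; last by move/eqP; rewrite (negbTE t0).
    pose m := (Num.trunc ((al - t) / (pi *+ 2))).+1.
    exists (al - (pi *+ 2) *~ m); first exact: cisB_period.
    rewrite ler_ndivlMr // mul1r lerBlDl -lerBlDr -mulrzr mulrC -ler_pdivrMr //.
    exact/ltW/truncnS_gt.
  pose m := (Num.trunc ((t - al) / (pi *+ 2))).+1.
  exists (al - (pi *+ 2) *~ (- m%:Z)); first exact: cisB_period.
  rewrite ler_pdivlMr // mul1r mulrNz opprK -lerBlDl -mulrzr mulrC -ler_pdivrMr //.
  exact/ltW/truncnS_gt.
pose j := Num.trunc (al' / t).
exists (k * j)%N; first by rewrite muln_gt0 k0 truncn_gt0.
rewrite exprM bk -cisMn.
have -> : cis (t *+ j) - cis al' = cis al' * (cis (t *+ j - al') - 1).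
  by rewrite cisD cisN mulrBr mulr1 mulrCA divff ?mulr1 // unit_neq0 // norm_cis.
rewrite normrM norm_cis mul1r (le_lt_trans (norm_cis_sub1 _)) // ltcR.
apply: le_lt_trans te.
have /andP[j1 j2] : j%:R <= al' / t < j.+1%:R by apply: truncn_itv; lra.
have -> : t *+ j - al' = t * (j%:R - al' / t).
  by rewrite mulrBr mulr_natr mulrCA divff // mulr1.
rewrite normrM ler_piMr //.
by rewrite ler_norml; move: j1 j2; rewrite -natr1; lra.
Qed.
End Angles.

(** * Moebius maps as disk automorphisms *)

Section MoebiusAutomorphism.
Variable R : realType.
Implicit Types l b z a : R[i].

Lemma mob_derivable l b z : `|b| < 1 -> disk z ->
  derivable (mob l b : R[i]^o -> R[i]^o) z 1.
Proof. by move=> hb hz; apply: fracl_derivable; exact: mob_den_neq0. Qed.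

(** This is [mobK] for the inverse parameters, since inverting twice restores l and b. *)
Lemma mobVK l b z : `|l| = 1 -> `|b| < 1 -> `|z| < 1 ->
  mob l b (mob l^-1 (l * b) z) = z.
Proof.
move=> hl hb hz.
have := @mobK R l^-1 (l * b) z; rewrite invrK mulKf ?unit_neq0 //; apply => //.
  by rewrite normfV hl invr1.
by rewrite normrM hl mul1r.
Qed.

Lemma mob_automorphism l b : `|l| = 1 -> `|b| < 1 -> disk_automorphism (mob l b).
Proof.
move=> hl hb; split; first by move=> z; exact: mob_derivable.
split.
- by move=> z hz; exact: mob_disk.
- move=> x y /set_mem hx /set_mem hy e.
  by rewrite -(mobK hl hb hx) e mobK.
- move=> z hz; exists (mob l^-1 (l * b) z); last exact: mobVK.
  by apply: mob_disk => //; [rewrite normfV hl invr1 | rewrite normrM hl mul1r].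
Qed.

Lemma disk_near a : disk a -> \forall z \near (a : R[i]^o), disk z.
Proof.
move=> ha; apply/nbhs_ballP; exists (1 - `|a|) => /=; first by rewrite subr_gt0.
move=> z; rewrite /ball /= /disk /= distrC => h.
rewrite -(subrK a z) (le_lt_trans (ler_normD _ _)) //.
by rewrite -ltrBrDr.
Qed.

Lemma cderiv_mob l b a (g : R[i] -> R[i]) : `|b| < 1 -> disk a ->
  (forall z, disk z -> g z = mob l b z) ->
  cderiv g a = l * ((b^*)%C * b - 1) / (1 - (b^*)%C * a) ^+ 2.
Proof.
move=> hb ha e; apply: fracl_derive1; first exact: mob_den_neq0.
by apply: filterS (disk_near ha) => z /e.
Qed.

Lemma elliptic_mob (phi : R[i] -> R[i]) : elliptic phi ->
  exists l b : R[i], [/\ `|l| = 1, `|b| < 1 &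
    forall z, disk z -> phi z = mob l b z].
Proof.
move=> [l [b [hl hb h _ _]]]; exists l, b; split=> // z hz.
have := h z hz; rewrite /disk_moebius /moebius.
case: ifP => // _ [<-]; rewrite /mob mulrBr addrC mulNr.
by congr (_ / _); rewrite mulNr addrC.
Qed.
End MoebiusAutomorphism.

(** * Bounded operators and their spectra *)

Section Operators.
Variables (R : realType) (X : completeNormedModType R[i]).
Implicit Types (S T Q : X -> X) (mu : R[i]).

Lemma bounded_ge0 T : bounded_operator T ->
  exists2 M : R, 0 <= M & forall f, `|T f| <= M%:C%C * `|f|.
Proof.
move=> [_ [M hM]]; exists `|M| => // f.
by rewrite (le_trans (hM f)) // ler_wpM2r // lecR ler_norm.
Qed.

Lemma bounded_add T S : bounded_operator T -> bounded_operator S ->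
  bounded_operator (fun f => T f + S f).
Proof.
move=> [lT [M hM]] [lS [N hN]]; split.
  by move=> c f g /=; rewrite lT lS /= scalerDr addrACA.
exists (M + N) => f; rewrite rmorphD mulrDl.
by rewrite (le_trans (ler_normD _ _)) // lerD.
Qed.

Lemma bounded_scale mu T : bounded_operator T ->
  bounded_operator (fun f => mu *: T f).
Proof.
move=> hT; have [M M0 hM] := bounded_ge0 hT; case: hT => lT _; split.
  by move=> c f g /=; rewrite lT scalerDr !scalerA mulrC.
exists (Normc.normc mu * M) => f.
by rewrite normrZ rmorphM -mulrA ler_wpM2l.
Qed.

Lemma bounded_comp T S : bounded_operator T -> bounded_operator S ->
  bounded_operator (fun f => T (S f)).
Proof.
move=> hT [lS [N hN]]; have [M M0 hM] := bounded_ge0 hT; case: hT => lT _; split.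
  by move=> c f g /=; rewrite lS lT.
exists (M * N) => f; rewrite (le_trans (hM _)) // rmorphM -mulrA.
by rewrite ler_wpM2l ?ler0c.
Qed.

Lemma bounded_zero : bounded_operator (fun _ : X => 0 : X).
Proof.
split; first by move=> c f g /=; rewrite scaler0 addr0.
by exists 0 => f; rewrite normr0 mul0r.
Qed.

Lemma bounded_id : bounded_operator (fun f : X => f).
Proof. by split=> //; exists 1 => f; rewrite mul1r. Qed.

Lemma bounded_iter n T : bounded_operator T -> bounded_operator (iter n T).
Proof.
move=> hT; elim: n => [|n IH]; first exact: bounded_id.
exact: (@bounded_comp T (iter n T)).
Qed.

Lemma bounded_additive T : bounded_operator T -> {morph T : f g / f + g}.
Proof. by move=> [lT _] f g; have := lT 1 f g; rewrite !scale1r. Qed.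

Lemma bounded_homogeneous T : bounded_operator T ->
  forall mu, {morph T : f / mu *: f}.
Proof.
move=> hT mu f; have [lT _] := hT.
have T0 : T 0 = 0.
  by apply: (addIr (T 0)); rewrite -(bounded_additive hT) !add0r.
by have := lT mu f 0; rewrite !addr0 T0 addr0.
Qed.

(** Q is the sum of mu^(n-1-i) T^i over i < n, built by Q_(n+1) = T^n + mu Q_n. Both orders of
    composition are kept because invertibility is two-sided. *)
Lemma geometric_factor T mu n : bounded_operator T -> exists2 Q,
  bounded_operator Q &
  (forall f, T (Q f) - mu *: Q f = iter n T f - mu ^+ n *: f) /\
  (forall f, Q (T f - mu *: f) = iter n T f - mu ^+ n *: f).
Proof.
move=> hT; have TD := bounded_additive hT; have TZ := bounded_homogeneous hT.
elim: n => [|n [Q hQ [IH1 IH2]]].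
  exists (fun=> 0); first exact: bounded_zero.
  have T0 : T 0 = 0 by have := TZ 0 0; rewrite !scale0r.
  by split=> f /=; rewrite expr0 scale1r subrr ?T0 ?scaler0 ?subrr.
exists (fun f => iter n T f + mu *: Q f).
  by apply: bounded_add; [exact: bounded_iter | exact: bounded_scale].
have iD : {morph iter n T : f g / f + g}.
  by apply: bounded_additive; exact: bounded_iter.
have iZ : forall nu, {morph iter n T : f / nu *: f}.
  by apply: bounded_homogeneous; exact: bounded_iter.
have alg (u v w : X) : u - mu *: v + mu *: (v - mu ^+ n *: w) = u - mu ^+ n.+1 *: w.
  by rewrite scalerBr addrA subrK scalerA -exprS.
split=> f /=.
  rewrite TD TZ -(alg _ (iter n T f)) -IH1 !scalerDr scalerN opprD.
  by rewrite !addrA; congr (_ + _); rewrite addrAC.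
have iB : iter n T (T f - mu *: f) = T (iter n T f) - mu *: iter n T f.
  by rewrite -scaleNr iD iZ scaleNr -iterSr.
by rewrite iB IH2 alg.
Qed.

(** Here T^n - mu^n is the scalar 1 - mu^n; when it is nonzero, dividing the factor Q by it inverts
    T - mu. *)
Lemma power_id_spectrum T n : bounded_operator T ->
  (forall f, iter n T f = f) -> spectrum T `<=` [set mu | mu ^+ n = 1].
Proof.
move=> hT Tn mu; apply: contra_notP => /eqP hmu.
have hd : 1 - mu ^+ n != 0 by rewrite subr_eq0 eq_sym.
have [Q hQ [q1 q2]] := geometric_factor mu n hT.
have e f : iter n T f - mu ^+ n *: f = (1 - mu ^+ n) *: f.
  by rewrite Tn scalerBl scale1r.
exists (fun f => (1 - mu ^+ n)^-1 *: Q f); split.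
- exact: bounded_scale.
- by move=> f /=; rewrite q2 e scalerA mulVf // scale1r.
- move=> f /=; rewrite bounded_homogeneous // scalerA mulrC -scalerA -scalerBr q1 e.
  by rewrite scalerA mulVf // scale1r.
Qed.

(** From T - mu = -mu (S - mu^-1) T, an inverse Q of S - mu^-1 yields the inverse -mu^-1 S Q of T -
    mu. *)
Lemma spectrum_inverse T S mu : bounded_operator T -> bounded_operator S ->
  cancel T S -> cancel S T -> spectrum T mu -> mu != 0 /\ spectrum S mu^-1.
Proof.
move=> hT hS TS ST hmu.
have mu0 : mu != 0.
  apply/eqP => mu0; apply: hmu; exists S; split => // f; rewrite mu0 scale0r subr0 //.
split=> //; apply: contra_not hmu => -[Q [hQ q1 q2]].
have e f : T f - mu *: f = - mu *: (S (T f) - mu^-1 *: T f).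
  by rewrite scalerBr scalerA mulNr divff // scaleN1r opprK TS scaleNr addrC.
exists (fun f => - mu^-1 *: S (Q f)); split.
- by apply: bounded_scale; exact: bounded_comp.
- move=> f /=; rewrite e bounded_homogeneous // q1.
  by rewrite bounded_homogeneous // TS scalerA mulrNN mulVf // scale1r.
- move=> f /=; rewrite e.
  have -> : T (- mu^-1 *: S (Q f)) = - mu^-1 *: Q f.
    by rewrite bounded_homogeneous // ST.
  rewrite [S _]bounded_homogeneous // [mu^-1 *: (_ *: _)]scalerA mulrC -scalerA.
  by rewrite -scalerBr scalerA mulrNN divff // scale1r q2.
Qed.

Lemma spectrum_le_radius T mu : spectral_radius T = 1 -> spectrum T mu -> `|mu| <= 1.
Proof.
move=> r1 hmu.
(* [sup] defaults to 0 on empty or unbounded sets, so the value 1 certifies a genuine supremum. *)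
have hs : has_sup [set Normc.normc nu | nu in spectrum T].
  apply: contrapT => h; move: r1; rewrite /spectral_radius sup_out //.
  by move=> /esym/eqP; rewrite oner_eq0.
have -> : `|mu| = (Normc.normc mu)%:C%C by [].
rewrite (@lecR _ _ 1) -r1; apply: sup_upper_bound => //.
by exists mu.
Qed.

(* A limit of eigenvalues is an approximate eigenvalue. *)
Lemma closure_eigenvalues_spectrum T (A : set R[i]) :
  (forall c, A c -> exists2 f : X, f != 0 & T f = c *: f) ->
  cclosure A `<=` spectrum T.
Proof.
move=> hA mu clmu [S [hS ST _]].
have [M M0 hM] := bounded_ge0 hS.
(* If M bounds the inverse of T - mu, an eigenvector f for c satisfies |f| <= M |c - mu| |f|, which
   is absurd when |c - mu| < 1/(M + 1). Adding 1 covers M = 0. *)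
have e0 : 0 < ((M + 1)^-1)%:C%C :> R[i] by rewrite ltcR invr_gt0 ltr_wpDl.
have [c [/hA[f f0 Tf] hc]] := clmu _ (nbhsx_ballx (mu : R[i]^o) _ e0).
have := hM (T f - mu *: f); rewrite ST Tf -scalerBl normrZ mulrA.
rewrite -{1}(mul1r `|f|) ler_pM2r ?normr_gt0 // => h1.
have : M%:C%C * `|c - mu| < 1.
  have hc' : `|c - mu| < ((M + 1)^-1)%:C%C by rewrite distrC.
  apply: (@le_lt_trans _ _ (M%:C%C * ((M + 1)^-1)%:C%C)).
    by apply: ler_wpM2l; rewrite ?ler0c // ltW.
  by rewrite -rmorphM (@ltcR _ _ 1) ltr_pdivrMr ?mul1r ?ltrDl // ltr_wpDl.
by move/(le_lt_trans h1); rewrite ltxx.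
Qed.
End Operators.

(** * Composition operators and their eigenvectors *)

Section CompositionOperators.
Variables (R : realType) (X : banach_analytic R).
Implicit Types (phi psi : R[i] -> R[i]) (f : X) (z : R[i]).

Lemma ba_fun0 z : disk z -> ba_fun (0 : X) z = 0.
Proof.
move=> hz; have := ba_fun_linear (-1) (0 : X) 0 hz.
by rewrite scaler0 addr0 mulN1r addNr.
Qed.

Lemma ba_funZ (c : R[i]) f z : disk z -> ba_fun (c *: f) z = c * ba_fun f z.
Proof.
by move=> hz; have := ba_fun_linear c f 0 hz; rewrite addr0 ba_fun0 // addr0.
Qed.

(** Boundedness includes that f o phi lies in X, so [xget] does not return its default 0. *)
Lemma comp_op_represents phi f : comp_bounded X phi ->
  represents (comp_op phi f) (ba_fun f \o phi).
Proof.
move=> [h _]; have [g hg] := h f.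
exact: (@xgetPex X 0 [set g : X | represents g (ba_fun f \o phi)] (ex_intro _ g hg)).
Qed.

(** Composition reverses the order: C_psi (C_phi f) = f o phi o psi. *)
Lemma comp_opK phi psi : comp_bounded X phi -> comp_bounded X psi ->
  (forall z, disk z -> disk (psi z)) -> (forall z, disk z -> phi (psi z) = z) ->
  cancel (@comp_op R X phi) (@comp_op R X psi).
Proof.
move=> h1 h2 hd hK f; apply: ba_fun_inj => z hz.
by rewrite (comp_op_represents _ h2) //= (comp_op_represents _ h1) /= ?hK //; exact: hd.
Qed.

Lemma iter_comp_op phi n f : comp_bounded X phi ->
  (forall z, disk z -> disk (phi z)) ->
  represents (iter n (@comp_op R X phi) f) (ba_fun f \o iter n phi).
Proof.
move=> hc hd; elim: n => [//|n IH] z hz.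
by rewrite iterS (comp_op_represents _ hc) //= IH /= -?iterSr //; exact: hd.
Qed.

(** The eigenvector is psi^k, which lies in X as the image of z^k under C_psi; the intertwining
    relation raised to the power k gives the eigenvalue. *)
Lemma eigenvector_power phi psi (c : R[i]) k :
  comp_bounded X phi -> comp_bounded X psi ->
  (forall z, disk z -> disk (phi z)) -> (forall z, disk z -> disk (psi z)) ->
  (forall z, disk z -> psi (phi z) = c * psi z) ->
  (exists2 z, disk z & psi z != 0) ->
  (exists f : X, represents f (fun z => z ^+ k)) ->
  exists2 f : X, f != 0 & comp_op phi f = c ^+ k *: f.
Proof.
move=> hphi hpsi dphi dpsi conj [w hw psiw] [f hf].
have gE z : disk z -> ba_fun (comp_op psi f) z = psi z ^+ k.
  by move=> hz; rewrite (comp_op_represents _ hpsi) //= hf //; exact: dpsi.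
exists (comp_op psi f).
  apply/eqP => g0; have := gE w hw; rewrite g0 ba_fun0 // => /esym/eqP.
  by rewrite (negbTE (expf_neq0 k psiw)).
apply: ba_fun_inj => z hz.
rewrite (comp_op_represents _ hphi) //= ba_funZ // !gE //; last exact: dphi.
by rewrite conj // exprMn.
Qed.
End CompositionOperators.

(** * Powers of a unimodular number *)

Section PowersOfUnit.
Variable R : realType.
Implicit Types c : R[i].

(** Take for m the multiplicative order of c: every m-th root of unity is a power of the primitive
    root c. *)
Lemma positive_powers_root c n : (1 <= n)%N -> c ^+ n = 1 ->
  exists2 m : nat, (1 <= m)%N & c ^+ m = 1 /\
    positive_powers c = [set mu | mu ^+ m = 1].
Proof.
move=> n0 cn; have [m prim _] := prim_order_exists n0 cn.
have m0 := prim_order_gt0 prim; have cm := prim_expr_order prim.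
exists m => //; split=> //; apply/seteqP; split=> mu.
  by move=> [k _ <-] /=; rewrite -exprM mulnC exprM cm expr1n.
(* The exponent i may be 0; adding m makes it positive and keeps the power. *)
move=> /= /(prim_rootP prim)[i ->]; exists (i + m)%N.
  by rewrite /= addn_gt0 m0 orbT.
by rewrite exprD cm mulr1.
Qed.

Lemma finite_positive_powers c n : (1 <= n)%N -> c ^+ n = 1 ->
  finite_set (positive_powers c).
Proof.
move=> n0 cn; have [m prim _] := prim_order_exists n0 cn.
apply: (@sub_finite_set _ _ [set c ^+ k | k in `I_m]).
  move=> mu [k _ <-]; exists (k %% m)%N.
    by rewrite /= ltn_mod (prim_order_gt0 prim).
  exact: prim_expr_mod.
by apply: finite_image; exact: finite_II.
Qed.

Lemma cclosure_finite (A : set R[i]) : finite_set A -> cclosure A = A.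
Proof.
move=> fA; have cA : closed (A : set R[i]^o).
  have acc : accessible_space R[i]^o.
    by apply: hausdorff_accessible; exact: norm_hausdorff.
  by have [h _] := @accessible_finite_set_closed R[i]^o; exact: h acc A fA.
exact/esym/(iffLR (@closure_id R[i]^o A) cA).
Qed.

Lemma roots_circle_subgroup m : (1 <= m)%N ->
  circle_subgroup [set mu : R[i] | mu ^+ m = 1].
Proof.
move=> m0; split=> [mu /= h||x y /= hx hy|x /= hx].
- by apply/eqP; rewrite -(@pexpr_eq1 _ _ m) // -normrX h normr1.
- by rewrite /= expr1n.
- by rewrite exprMn hx hy mulr1.
- by rewrite exprVn hx invr1.
Qed.

Lemma circle_sub_closure_powers c : `|c| = 1 ->
  ~ (exists n : nat, (1 <= n)%N /\ c ^+ n = 1) ->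
  @circle R `<=` cclosure (positive_powers c).
Proof.
move=> /norm1_cis[b ->] nroot z hz B /nbhs_ballP[e /= e0 hB].
(* The radius e is an element of R[i]; being positive, it is real. *)
have er : e = (complex.Re e)%:C%C by rewrite RRe_real // gtr0_real.
have er0 : 0 < complex.Re e by rewrite -ltcR -er.
have [k k0 hk] := cis_dense nroot hz er0.
exists (cis b ^+ k); split; first by exists k.
by apply: hB; rewrite /ball /= distrC er.
Qed.
End PowersOfUnit.

(** * The spectrum of an elliptic composition operator *)

Theorem theorem3p4 (R : realType) (X : banach_analytic R)
    (hF : forall h : R[i] -> R[i], @family_F R h ->
       exists f : X, represents f h)
    (hC : forall psi : R[i] -> R[i], disk_automorphism psi ->
       comp_bounded X psi /\ spectral_radius (@comp_op R X psi) = 1)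
    (phi : R[i] -> R[i]) (hphi : disk_automorphism phi) (hell : elliptic phi)
    (a : R[i]) (ha : disk a) (hfix : phi a = a) :
  let G := cclosure (positive_powers (cderiv phi a)) in
  [/\ spectrum (@comp_op R X phi) = G,
      (exists n : nat, (1 <= n)%N /\ cderiv phi a ^+ n = 1) ->
        finite_set G /\ circle_subgroup G
    & ~ (exists n : nat, (1 <= n)%N /\ cderiv phi a ^+ n = 1) ->
        G = @circle R].
Proof.
move=> G.
have [l [b [hl hb phiE]]] := elliptic_mob hell.
have mfix : mob l b a = a by rewrite -phiE.
have dphi z : disk z -> disk (phi z) by move=> hz; rewrite phiE //; exact: mob_disk.
have n1 : `|1 : R[i]| = 1 by rewrite normr1.
pose psi := mob 1 a.
have dpsi z : disk z -> disk (psi z) by move=> hz; exact: mob_disk.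
have psiK z : disk z -> psi (psi z) = z.
  by move=> hz; have := mobK n1 ha hz; rewrite invr1 mul1r.
have lamE := cderiv_mob hb ha phiE.
have lam1 : `|cderiv phi a| = 1 by rewrite lamE; exact: norm_multiplier.
have conj z : disk z -> psi (phi z) = cderiv phi a * psi z.
  by move=> hz; rewrite lamE phiE //; exact: mob_conj_rotation.
have [bphi rphi] := hC _ hphi.
have [bpsi _] := hC _ (mob_automorphism n1 ha).
have Gsub : G `<=` spectrum (@comp_op R X phi).
  apply: closure_eigenvalues_spectrum => _ [k k0 <-].
  apply: (@eigenvector_power R X phi psi) => //.
    (* A point where psi does not vanish: the involution psi takes the value 1/2 at psi(1/2). *)
    have h2 : disk (2^-1 : R[i]) by rewrite /disk /= normfV normr_nat invf_lt1 ?ltr1n.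
    exists (psi 2^-1); first exact: dpsi.
    by rewrite psiK // invr_eq0 pnatr_eq0.
  by apply: hF; right; exists k.
have Gfin n : (1 <= n)%N -> cderiv phi a ^+ n = 1 -> G = positive_powers (cderiv phi a).
  by move=> n0 h; apply: cclosure_finite; exact: finite_positive_powers h.
have subcircle : spectrum (@comp_op R X phi) `<=` @circle R.
  (* The inverse automorphism, to which [hC] also applies: it bounds |mu^-1| by 1, as [rphi] bounds
     |mu|. *)
  pose phiV := mob l^-1 (l * b).
  have hlV : `|l^-1| = 1 by rewrite normfV hl invr1.
  have hlb : `|l * b| < 1 by rewrite normrM hl mul1r.
  have [bV rV] := hC _ (mob_automorphism hlV hlb).
  have dV z : disk z -> disk (phiV z) by move=> hz; exact: mob_disk.
  have K1 : cancel (@comp_op R X phi) (@comp_op R X phiV).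
    by apply: comp_opK => // z hz; rewrite phiE; [exact: mobVK | exact: dV].
  have K2 : cancel (@comp_op R X phiV) (@comp_op R X phi).
    by apply: comp_opK => // z hz; rewrite phiE //; exact: mobK.
  move=> mu hmu; have [mu0 hV] := spectrum_inverse bphi.2 bV.2 K1 K2 hmu.
  apply/eqP; rewrite /= eq_le (spectrum_le_radius rphi hmu) /=.
  have := spectrum_le_radius rV hV.
  by rewrite normfV invf_le1 // normr_gt0.
have [[n [n0 hn]]|nroot] := pselect (exists n : nat,
  (1 <= n)%N /\ cderiv phi a ^+ n = 1).
  have GP := Gfin n n0 hn.
  have [m m0 [hm PE]] := positive_powers_root n0 hn.
  split; last by move=> []; exists n.
    apply/seteqP; split => //; rewrite GP PE.
    apply: power_id_spectrum; first exact: bphi.2.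
    move=> f; apply: ba_fun_inj => z hz; rewrite iter_comp_op //=; congr (ba_fun f _).
    (* Through psi, the iterate phi^k is multiplication by the k-th power of the multiplier; for k =
       m that is the identity, so phi^m is the identity on the disk. *)
    have it k : disk (iter k phi z) /\ psi (iter k phi z) = cderiv phi a ^+ k * psi z.
      elim: k => [|k [d IH]]; first by rewrite expr0 mul1r.
      by split; [exact: dphi | rewrite iterS conj // IH mulrA exprS].
    have [d e] := it m; rewrite -(psiK _ d) e hm mul1r psiK //.
  move=> _; split; first by rewrite GP; exact: finite_positive_powers hn.
  by rewrite GP PE; exact: roots_circle_subgroup.
(* The inclusions circle <= G <= spectrum <= circle close up. *)
have GC : G = @circle R.
  apply/seteqP; split; first exact: subset_trans Gsub subcircle.
  exact: circle_sub_closure_powers.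
by split=> //; apply/seteqP; split=> //; rewrite GC.
Qed.
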